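(* Let $\mathscr S=(S,;,\mathsf{d},\mathsf{r})$ be an algebra with $;$ binary and associative and $\mathsf{d},\mathsf{r}$ unary, satisfying for all $x,y,z\in S$: $\mathsf{d}(x);x=x$; $\ \mathsf{d}(x);\mathsf{d}(y)=\mathsf{d}(y);\mathsf{d}(x)$; $\ \mathsf{d}(\mathsf{d}(x))=\mathsf{d}(x)$; $\ \mathsf{d}(x);\mathsf{d}(x;y)=\mathsf{d}(x;y)$; $\ x;\mathsf{d}(y)=\mathsf{d}(x;y);x$; $x;\mathsf{r}(x)=x$; $\ \mathsf{r}(x);\mathsf{r}(y)=\mathsf{r}(y);\mathsf{r}(x)$; $\ \mathsf{r}(\mathsf{r}(x))=\mathsf{r}(x)$; $\ \mathsf{r}(x;y);\mathsf{r}(y)=\mathsf{r}(x;y)$; $\ \mathsf{r}(\mathsf{r}(x);y)=\mathsf{r}(x;y)$; $\ x;y=x;z\Rightarrow\mathsf{r}(x);y=\mathsf{r}(x);z$; $\mathsf{d}(\mathsf{r}(x))=\mathsf{r}(x)$ and $\mathsf{r}(\mathsf{d}(x))=\mathsf{d}(x)$. Then $\mathscr S$ has a representation on a base of size at most $|S|^{1+|S|}$, and on a base of size at most $(|S|-1)^{|S|}$ if there is a $0$ element with $\mathsf{d}(0)=0$.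
   Context: A (unary) function on a set $X$ is a partial map $f\colon X\to X$, identified with its graph. For functions on $X$: composition $f;g=\{(x,y)\mid \exists z\,((x,z)\in f\ \&\ (z,y)\in g)\}$; domain $\mathsf{d}(f)=\{(x,x)\mid \exists y\,(x,y)\in f\}$; range $\mathsf{r}(f)=\{(y,y)\mid\exists x\,(x,y)\in f\}$. A representation of a $\{;,\mathsf{d},\mathsf{r}\}$-algebra on the base $X$ is an isomorphism from it onto a family of functions on $X$ closed under these operations, equipped with these operations. A $0$ element is an element $0\in S$ with $0;x=x;0=0$ for all $x\in S$. *)

(* Defs.v *)
From mathcomp Require Import all_boot.
From mathcomp Require Import boolp classical_sets functions cardinality.

Set Implicit Arguments.
Unset Strict Implicit.
Unset Printing Implicit Defensive.

Local Open Scope classical_set_scope.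

(* [op x y], [d x], [r x] stand for the abstract x;y, d(x), r(x). *)
Record dr_axioms (S : Type) (op : S -> S -> S) (d r : S -> S) : Prop := {
  dr_assoc : forall x y z, op x (op y z) = op (op x y) z;
  dr_dx_x : forall x, op (d x) x = x;
  dr_dC : forall x y, op (d x) (d y) = op (d y) (d x);
  dr_dd : forall x, d (d x) = d x;
  dr_d_op : forall x y, op (d x) (d (op x y)) = d (op x y);
  dr_op_d : forall x y, op x (d y) = op (d (op x y)) x;
  dr_x_rx : forall x, op x (r x) = x;
  dr_rC : forall x y, op (r x) (r y) = op (r y) (r x);
  dr_rr : forall x, r (r x) = r x;
  dr_r_op : forall x y, op (r (op x y)) (r y) = r (op x y);
  dr_r_congr : forall x y, r (op (r x) y) = r (op x y);
  dr_quasi : forall x y z, op x y = op x z -> op (r x) y = op (r x) z;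
  dr_dr : forall x, d (r x) = r x;
  dr_rd : forall x, r (d x) = d x
}.

Definition is_zero (S : Type) (op : S -> S -> S) (zero : S) : Prop :=
  forall x, op zero x = zero /\ op x zero = zero.

(* A unary function on X is a partial map, identified with its graph. *)
Definition is_pfun (X : Type) (f : set (X * X)) : Prop :=
  forall x y z, f (x, y) -> f (x, z) -> y = z.

(* Diagrammatic order: first f, then g. *)
Definition fcomp (X : Type) (f g : set (X * X)) : set (X * X) :=
  [set p | exists z, f (p.1, z) /\ g (z, p.2)].

Definition fdom (X : Type) (f : set (X * X)) : set (X * X) :=
  [set p | p.1 = p.2 /\ exists y, f (p.1, y)].

Definition fran (X : Type) (f : set (X * X)) : set (X * X) :=
  [set p | p.1 = p.2 /\ exists x, f (x, p.1)].

Record function_algebra (X : Type) (F : set (set (X * X))) : Prop := {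
  fa_pfun : forall f, F f -> is_pfun f;
  fa_comp : forall f g, F f -> F g -> F (fcomp f g);
  fa_dom : forall f, F f -> F (fdom f);
  fa_ran : forall f, F f -> F (fran f)
}.

Record is_representation (S : Type) (op : S -> S -> S) (d r : S -> S)
    (X : Type) (F : set (set (X * X))) (theta : S -> set (X * X)) : Prop := {
  rep_alg : function_algebra F;
  rep_bij : set_bij [set: S] F theta;
  rep_comp : forall x y, theta (op x y) = fcomp (theta x) (theta y);
  rep_dom : forall x, theta (d x) = fdom (theta x);
  rep_ran : forall x, theta (r x) = fran (theta x)
}.

Definition representable_on (S : Type) (op : S -> S -> S) (d r : S -> S)
    (X : Type) : Prop :=
  exists (F : set (set (X * X))) (theta : S -> set (X * X)),
    is_representation op d r F theta.

(* Main.v *)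
Require Import Defs.
From mathcomp Require Import all_boot.
From mathcomp Require Import boolp classical_sets functions cardinality.

(** The abstract [x] is made to act on all labellings of a certain kind.  A point
    [F] consists of a nonzero projection [e] (an element with
    [d e = e]) and an arbitrary labelling of [{t | d t = e}] by nonzero
    elements; think of [e] as the least projection fixing the point, and of the
    label at [t] as an observation made after moving the point along [t].
    The point can be moved along [x] when [e] lies below [d x]; the result
    carries the projection [r (e x)] and the labelling [t |-> F (e x t)], since
    observing [t] after [x] is observing [e x t].

    That [x |-> (moving along x)] respects composition and domain is a
    computation with projections.  The crux is the range: every point [G] whose
    projection [e] lies below [r a] must be reached by [a].  A predecessor
    should carry the projection [d (a e)] and the label [G t] at [a e t], and be
    labelled arbitrarily elsewhere.  As all labellings are admitted, the only
    obstruction is a clash [a e t = a e t'], and then the quasi-identity gives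
    [r (a e) t = r (a e) t'], that is [t = t'] (lemma [move_pred]).  Injectivity
    is seen on the points labelled by the identity (lemma [move_le]).

    Since [d 0 = 0], the element [0] is never in [{t | d t = e}], so its label is
    free to hold the projection [e].  A point thus becomes one function from [S]
    to the nonzero elements, which gives the bound [(|S|-1)^|S|].  Without a
    zero, one is adjoined (lemma [adjoin0_axioms]); restricting the
    representation of the larger algebra gives the bound
    [((|S|+1)-1)^(|S|+1) = |S|^(1+|S|)]. *)

Set Implicit Arguments.
Unset Strict Implicit.
Unset Printing Implicit Defensive.

Local Open Scope classical_set_scope.
Local Open Scope card_scope.

Lemma injective_card_le (T U : Type) (f : T -> U) :
  injective f -> [set: T] #<= [set: U].
Proof.
move=> f_inj; have fT_inj : {in [set: T] &, injective f} by move=> x y _ _ /f_inj.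
by rewrite -(card_le_eql (inj_card_eq fT_inj)); exact: card_leT.
Qed.

(** The family of functions is the image of [theta]; its closure under the
    operations is the homomorphism property. *)
Lemma representable_of_morphism (S : Type) (op : S -> S -> S) (d r : S -> S)
    (X : Type) (theta : S -> set (X * X)) :
    (forall x, is_pfun (theta x)) -> injective theta ->
    (forall x y, theta (op x y) = fcomp (theta x) (theta y)) ->
    (forall x, theta (d x) = fdom (theta x)) ->
    (forall x, theta (r x) = fran (theta x)) ->
  representable_on op d r X.
Proof.
move=> pfun_theta theta_inj thetaM thetad thetar.
exists (range theta), theta; split=> //.
- split.
  + by move=> _ [x _ <-].
  + by move=> _ _ [x _ <-] [y _ <-]; exists (op x y).
  + by move=> _ [x _ <-]; exists (d x).
  + by move=> _ [x _ <-]; exists (r x).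
- by apply: inj_bij => x y _ _ /theta_inj.
Qed.

Lemma representable_sub (S S' : Type) (op : S -> S -> S) (d r : S -> S)
    (op' : S' -> S' -> S') (d' r' : S' -> S') (h : S -> S') (X : Type) :
    injective h -> (forall x y, h (op x y) = op' (h x) (h y)) ->
    (forall x, h (d x) = d' (h x)) -> (forall x, h (r x) = r' (h x)) ->
  representable_on op' d' r' X -> representable_on op d r X.
Proof.
move=> h_inj hM hd hr [F [theta [[F_pfun _ _ _] [theta_F theta_inj _]]]].
move=> thetaM thetad thetar.
apply: (@representable_of_morphism _ _ _ _ _ (theta \o h)) => /=.
- by move=> x; apply: F_pfun; exact: theta_F.
- by move=> x y /(theta_inj _ _ (mem_set I) (mem_set I)) /h_inj.
- by move=> x y; rewrite hM thetaM.
- by move=> x; rewrite hd thetad.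
- by move=> x; rewrite hr thetar.
Qed.

(** * Projections *)

Section Projections.
Variables (S : Type) (op : S -> S -> S) (d r : S -> S).
Hypothesis ax : dr_axioms op d r.
Local Notation "x * y" := (op x y).

Let assoc := dr_assoc ax.

Lemma d_dop x y : d (d x * y) = d x * d y.
Proof. by rewrite (dr_op_d ax (d x)) (dr_dC ax) -{1}(dr_d_op ax (d x)) (dr_dd ax). Qed.

Lemma d_opd x y : d (x * d y) = d (x * y).
Proof. by rewrite (dr_op_d ax) d_dop (dr_dC ax) (dr_d_op ax). Qed.

Lemma d_restrict e s : d e = e -> e * d s = e -> d (e * s) = e.
Proof. by move=> de eds; rewrite -de d_dop de. Qed.

Lemma proj_idem e : d e = e -> e * e = e.
Proof. by move=> de; rewrite -{1}de (dr_dx_x ax). Qed.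

Lemma projC e f : d e = e -> d f = f -> e * f = f * e.
Proof. by move=> <- <-; exact: (dr_dC ax). Qed.

Lemma r_proj e : d e = e -> r e = e.
Proof. by move=> <-; exact: (dr_rd ax). Qed.

(** So [r x] is the least projection fixing [x] on the right: this is the
    quasi-identity applied to [x f = x = x (r x)]. *)
Lemma op_proj_r x f : x * f = x -> r x * f = r x.
Proof.
move=> xf; rewrite (dr_quasi ax (y := f) (z := r x)) ?xf ?(dr_x_rx ax)//.
by rewrite proj_idem // (dr_dr ax).
Qed.

(** The label that a moved point reads off at [e * x * t] is a genuine one. *)
Lemma d_label e x t : d e = e -> e * d x = e -> d t = r (e * x) -> d (e * x * t) = e.
Proof. by move=> de edx dt; rewrite -d_opd dt (dr_x_rx ax) d_restrict. Qed.

(** For a point with projection [e], moving along [x y] is possible exactly when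
    it is possible along [x] and then along [y], as the point reached by [x] has
    projection [r (e x)]. *)
Lemma le_d_op e x y : d e = e ->
  (e * d (x * y) = e) <-> (e * d x = e /\ r (e * x) * d y = r (e * x)).
Proof.
move=> de; split=> [edxy|[edx rdy]].
- split.
    by rewrite -edxy -assoc (dr_dC ax) (dr_d_op ax).
  by apply: op_proj_r; rewrite -assoc (dr_op_d ax) assoc edxy.
- have edy : (e * x) * d y = e * x by rewrite -{1}(dr_x_rx ax (e * x)) -assoc rdy (dr_x_rx ax).
  by rewrite -{1}de -d_dop de assoc -d_opd edy d_restrict.
Qed.

End Projections.

(** * The representation of an algebra with zero *)

Section Points.
Variables (S : Type) (op : S -> S -> S) (d r : S -> S).
Hypothesis ax : dr_axioms op d r.
Variable zero : S.
Hypothesis zeroP : is_zero op zero.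
Hypothesis d0 : d zero = zero.
Local Notation "x * y" := (op x y).

Let assoc := dr_assoc ax.

Lemma op0x x : zero * x = zero. Proof. by case: (zeroP x). Qed.
Lemma opx0 x : x * zero = zero. Proof. by case: (zeroP x). Qed.

Lemma d_eq0 x : d x = zero -> x = zero.
Proof. by move=> dx0; rewrite -(dr_dx_x ax x) dx0 op0x. Qed.

Lemma r_eq0 x : r x = zero -> x = zero.
Proof. by move=> rx0; rewrite -(dr_x_rx ax x) rx0 opx0. Qed.

(** [F zero] is the projection of the point and the values of [F] on
    [{t | d t = F zero}] are its labels.  The other values carry no information;
    they are set to [F zero], a nonzero element at hand. *)
Definition is_point (F : S -> S) : Prop :=
  [/\ forall t, F t <> zero, d (F zero) = F zero &
      forall t, d t <> F zero -> F t = F zero].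

Definition point : Type := {F : S -> S | is_point F}.

Implicit Types F G H : point.

Definition base_proj F : S := sval F zero.

Lemma d_base_proj F : d (base_proj F) = base_proj F.
Proof. by case: (svalP F). Qed.

Lemma base_proj_neq0 F : base_proj F <> zero.
Proof. by case: (svalP F) => F0 _ _; exact: F0. Qed.

Lemma point_ext F G : base_proj F = base_proj G ->
  (forall t, d t = base_proj F -> sval F t = sval G t) -> F = G.
Proof.
case: F G => [F FP] [G GP]; rewrite /base_proj /= => FG0 FG.
apply: eq_exist; apply/funext => t.
have [_ _ Fout] := FP; have [_ _ Gout] := GP.
have [dt|dt] := pselect (d t = F zero); first exact: FG.
by rewrite Fout // Gout -?FG0.
Qed.

(** Labels may be prescribed freely: both the images of a point and its
    predecessors are obtained in this way. *)
Lemma point_of_labels e (g : S -> S) : d e = e -> e <> zero ->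
    (forall t, d t = e -> g t <> zero) ->
  exists F, base_proj F = e /\ forall t, d t = e -> sval F t = g t.
Proof.
move=> de e0 g0; pose f t := if pselect (d t = e) then g t else e.
have fE t : d t = e -> f t = g t by rewrite /f; case: pselect.
have fout t : d t <> e -> f t = e by rewrite /f; case: pselect.
have f_zero : f zero = e by apply: fout; rewrite d0 => /esym.
have fP : is_point f.
  split; rewrite ?f_zero // => t.
  have [dt|dt] := pselect (d t = e); first by rewrite fE //; exact: g0.
  by rewrite fout.
by exists (exist _ f fP).
Qed.

Definition move (x : S) : set (point * point) :=
  [set p | [/\ base_proj p.1 * d x = base_proj p.1,
               base_proj p.2 = r (base_proj p.1 * x) &
               forall t, d t = base_proj p.2 ->
                 sval p.2 t = sval p.1 (base_proj p.1 * x * t)]].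

Lemma move_pfun x : is_pfun (move x).
Proof.
move=> F G H [/= _ eG lG] [/= _ eH lH].
apply: point_ext => [|t dt]; first by rewrite eG eH.
by rewrite lG // lH // eH -eG.
Qed.

Lemma move_total x F : base_proj F * d x = base_proj F -> exists G, move x (F, G).
Proof.
move=> Fdx; set e := base_proj F in Fdx *.
have dex : d (e * x) = e by exact: (d_restrict ax (d_base_proj F) Fdx).
have [||t _|G [eG lG]] := @point_of_labels (r (e * x)) (fun t => sval F (e * x * t)).
- exact: (dr_dr ax).
- move=> /r_eq0 ex0; apply: (@base_proj_neq0 F).
  by rewrite -/e -dex ex0 d0.
- by case: (svalP F).
by exists G; split=> //= t; rewrite eG; exact: lG.
Qed.

(** The labels prescribed on the elements [a * e * t] do not clash, by the
    quasi-identity: [r (a * e) = e] when [e] lies below [r a], so that [a * e]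
    can be cancelled on the left of [t] and [t'] with [d t = d t' = e]. *)
Lemma move_pred a G : base_proj G * r a = base_proj G -> exists F, move a (F, G).
Proof.
set e := base_proj G => era.
have de : d e = e by exact: d_base_proj.
have rae : r (a * e) = e.
  rewrite -(dr_r_congr ax) (projC ax (dr_dr ax a) de) era.
  exact: (r_proj ax de).
set c := d (a * e).
have dc : d c = c by exact: (dr_dd ax).
have ca : c * a = a * e by rewrite -[in RHS]de (dr_op_d ax).
have et t : d t = e -> e * t = t by move=> <-; exact: (dr_dx_x ax).
have cancel t t' : d t = e -> d t' = e -> a * e * t = a * e * t' -> t = t'.
  by move=> dt dt' /(dr_quasi ax); rewrite rae !et.
have c0 : c <> zero.
  move=> /d_eq0 ae0; apply: (@base_proj_neq0 G); rewrite -/e -rae ae0.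
  exact: (r_proj ax d0).
pose labelled u t := d t = e /\ u = a * e * t.
pose g u := if pselect (exists t, labelled u t) is left ex
            then sval G (sval (cid ex)) else c.
have gE t : d t = e -> g (a * e * t) = sval G t.
  rewrite /g => dt; case: pselect => [ex|]; last by case; exists t.
  by case: (cid ex) => t' [dt' aet] /=; rewrite (cancel t t').
have [||u _|F [eF lF]] := @point_of_labels c g => //.
  by rewrite /g; case: pselect => // ex; case: (svalP G).
exists F; split; rewrite /= ?eF -?/e.
- by rewrite -{1}dc -(d_dop ax) dc ca.
- by rewrite ca rae.
- move=> t dt; rewrite ca lF ?gE //.
  by rewrite -(d_opd ax) dt -assoc (proj_idem ax de).
Qed.

Lemma move_op x y : move (x * y) = fcomp (move x) (move y).
Proof.
have r_step F G : base_proj G = r (base_proj F * x) ->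
    r (base_proj F * (x * y)) = r (base_proj G * y).
  by move=> ->; rewrite (dr_r_congr ax) assoc.
have label_step F G t : move x (F, G) -> base_proj G * d y = base_proj G ->
    d t = r (base_proj G * y) ->
    sval G (base_proj G * y * t) = sval F (base_proj F * (x * y) * t).
  move=> [/= _ eG lG] Gy dt; rewrite lG; last exact: (d_label ax (d_base_proj G) Gy dt).
  by rewrite eG !assoc (dr_x_rx ax).
apply/seteqP; split=> [[F H] [/= Fxy eH lH]|[F H] [G [/= FG [/= Gy eH lH]]]].
- have [Fx rFxy] := (le_d_op ax x y (d_base_proj F)).1 Fxy.
  have [G FG] := move_total Fx; have [/= _ eG lG] := FG.
  have Gy : base_proj G * d y = base_proj G by rewrite eG.
  have eGH : base_proj H = r (base_proj G * y) by rewrite eH; exact: r_step.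
  exists G; split=> //; split=> //= t dt.
  by rewrite lH // (label_step F) // -eGH.
- have [/= Fx eG lG] := FG; split=> /=.
  + by apply/(le_d_op ax) => //; [exact: d_base_proj|rewrite -eG].
  + by rewrite eH; symmetry; exact: r_step.
  + by move=> t dt; rewrite lH // (label_step F) // -eH.
Qed.

(** The images of domain and range elements are thereby subsets of the identity,
    so that [move_d] and [move_r] only concern the points moved: these are given
    by [move_total] and [move_pred]. *)
Lemma move_proj f F G : d f = f ->
  move f (F, G) <-> F = G /\ base_proj F * f = base_proj F.
Proof.
move=> df; have eF_id t : d t = base_proj F -> base_proj F * t = t.
  by move=> <-; exact: (dr_dx_x ax).
have rF : r (base_proj F) = base_proj F by apply: (r_proj ax); exact: d_base_proj.
split=> [[/=]|[<- Ff]].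
- rewrite df => Ff; rewrite Ff rF => eG lG; split=> //.
  by apply: point_ext => // t dt; rewrite lG ?eG ?eF_id.
- by split; rewrite /= ?df ?Ff ?rF // => t dt; rewrite eF_id.
Qed.

Lemma move_d x : move (d x) = fdom (move x).
Proof.
apply/seteqP; split=> [[F G] /(move_proj _ _ (dr_dd ax x)) [<- Fx]|[F G] [/= <- [H [/= Fx _ _]]]].
- by split=> //; exact: move_total.
- by apply/(move_proj _ _ (dr_dd ax x)).
Qed.

Lemma move_r x : move (r x) = fran (move x).
Proof.
apply/seteqP; split=> [[F G] /(move_proj _ _ (dr_dr ax x)) [<- Fx]|[F G] [/= <- [H [/= _ eF _]]]].
- by split=> //; exact: move_pred.
- by apply/(move_proj _ _ (dr_dr ax x)); split=> //; rewrite eF (dr_r_op ax).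
Qed.

(** The point with projection [d a] labelled by the identity is moved by [a] to
    a point labelled by [t |-> a t], whose label at [r a] is [a]. *)
Lemma move_le a b : a <> zero -> move a `<=` move b ->
  d a * d b = d a /\ d a * b = a.
Proof.
move=> a0 ab.
have [|/d_eq0 //|t dt t0|F [eF lF]] := @point_of_labels (d a) id.
- exact: (dr_dd ax).
- by move: dt; rewrite t0 d0 => /esym /d_eq0.
have [|G FG] := @move_total a F; first by rewrite eF (proj_idem ax (dr_dd ax a)).
have [/= _ eG lG] := FG; have [/= Fb eGb lGb] := ab _ FG.
rewrite eF (dr_dx_x ax) in eG lG; rewrite eF in Fb eGb lGb.
split=> //.
have dG : d (r a) = base_proj G by rewrite eG (dr_dr ax).
have dabr : d a * b * r a = d a * b by rewrite -eG eGb (dr_x_rx ax).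
have := lG _ dG; rewrite (lGb _ dG) dabr (dr_x_rx ax) !lF //.
exact: (d_restrict ax (dr_dd ax a) Fb).
Qed.

Lemma move_inj : injective move.
Proof.
have zero_unique a b : move a = move b -> a = zero -> b = zero.
  move=> ab a0; apply: contrapT => b0.
  have [|_] := @move_le b a b0; first by rewrite ab.
  by rewrite a0 opx0 => /esym.
(* By [move_le] both ways, [d a] and [d b] lie below each other, hence coincide,
   and [a] is the restriction of [b] to [d a]. *)
move=> a b ab; have [a0|a0] := pselect (a = zero).
  by rewrite (zero_unique a b).
have b0 : b <> zero by move=> /(zero_unique b a (esym ab)).
have [|dab <-] := @move_le a b a0; first by rewrite ab.
have [|dba _] := @move_le b a b0; first by rewrite ab.
by rewrite -dab (dr_dC ax) dba (dr_dx_x ax).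
Qed.

Lemma representable_on_point : representable_on op d r point.
Proof.
exact: (representable_of_morphism move_pfun move_inj move_op move_d move_r).
Qed.

Lemma point_card_le : [set: point] #<= [set: S -> set_type [set~ zero]].
Proof.
have F0 F t : sval F t \in [set~ zero].
  by have [F0 _ _] := svalP F; apply/mem_set; exact: F0.
pose f F t : set_type [set~ zero] := exist _ (sval F t) (F0 F t).
apply: (@injective_card_le _ _ f) => -[F FP] [G GP] FG.
by apply: eq_exist; apply/funext => t; have /(congr1 (fun u => val (u t))) := FG.
Qed.

End Points.

(** * Adjoining a zero *)

Section Adjoin0.
Variables (S : Type) (op : S -> S -> S) (d r : S -> S).
Hypothesis ax : dr_axioms op d r.

Definition zero0 : unit + S := inl tt.

Definition op0 (x y : unit + S) : unit + S :=
  match x, y with inr x, inr y => inr (op x y) | _, _ => zero0 end.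

Definition map0 (f : S -> S) (x : unit + S) : unit + S :=
  if x is inr x then inr (f x) else zero0.

(** The quasi-identity survives because products of nonzero elements are
    nonzero. *)
Lemma adjoin0_axioms : dr_axioms op0 (map0 d) (map0 r).
Proof.
case: ax => ? ? ? ? ? ? ? ? ? ? ? quasi ? ?.
split=> [[[]|x] [[]|y] [[]|z]|[[]|x]|[[]|x] [[]|y]|[[]|x]|[[]|x] [[]|y]|[[]|x] [[]|y]
  |[[]|x]|[[]|x] [[]|y]|[[]|x]|[[]|x] [[]|y]|[[]|x] [[]|y]|[[]|x] [[]|y] [[]|z]|[[]|x]|[[]|x]]
  //=; try by move=> *; congr inr.
by case=> /quasi ->.
Qed.

Lemma zero0P : is_zero op0 zero0.
Proof. by case. Qed.

Lemma nonzero0_inr (u : set_type [set~ zero0]) : exists s, val u = inr s.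
Proof.
case: u => [[[]|s] u0]; last by exists s.
by have := set_mem u0; case.
Qed.

Lemma fun_nonzero0_card_le (T : Type) :
  [set: T -> set_type [set~ zero0]] #<= [set: T -> S].
Proof.
have [p pP] := choice nonzero0_inr.
apply: (@injective_card_le _ _ (fun f => p \o f)) => f g fg.
apply/funext => t; apply: val_inj; rewrite !pP.
by have /(congr1 (@^~ t)) /= -> := fg.
Qed.

End Adjoin0.

Theorem theorem6p1 (S : Type) (op : S -> S -> S) (d r : S -> S)
    (ax : dr_axioms op d r) :
  (exists X : Type,
     representable_on op d r X /\ [set: X] #<= [set: (unit + S)%type -> S])
  /\
  (forall zero : S, is_zero op zero -> d zero = zero ->
     exists X : Type,
       representable_on op d r X /\
       [set: X] #<= [set: S -> set_type [set~ zero]]).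
Proof.
split=> [|zero zeroP d0].
- exists (point (map0 d) (zero0 S)); split.
  + apply: (@representable_sub _ _ _ _ _ (op0 op) (map0 d) (map0 r) inr) => //.
      by move=> x y [].
    exact: (representable_on_point (adjoin0_axioms ax) (zero0P op) erefl).
  + exact: (card_le_trans (point_card_le _ _) (fun_nonzero0_card_le _ _)).
- exists (point d zero); split; last exact: point_card_le.
  exact: (representable_on_point ax zeroP d0).
Qed.
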